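(* Consider the asymmetric binary perceptron (ABP) model. Assume that there exists a function $\alpha_c(\kappa)$ such that for every $\kappa>0$: (i) for every $\alpha>\alpha_c(\kappa)$ and $m=\lfloor\alpha n\rfloor$, with high probability there are no solutions (i.e. $S(G)=\emptyset$); (ii) for every $0<\alpha<\alpha_c(\kappa)$ and $m=\lfloor\alpha n\rfloor$, with high probability there is a solution (i.e. $S(G)\neq\emptyset$). Assume moreover that $\alpha_c(\kappa)$ is a right-continuous function of $\kappa$. Then for every $\kappa>0$ and every $0<\alpha<\alpha_c(\kappa)$ there exists $d>0$ such that, with high probability, there is a cluster of $S(G)$ of diameter at least $dn$.
   Context: Let $\alpha>0$ and $m=\lfloor\alpha n\rfloor$. Let $G$ be a random $m\times n$ matrix with i.i.d. entries uniform on $\{+1,-1\}$. ABP model with parameter $\kappa$: the set of solutions is $$S(G)=\Big\{X\in\{-1,+1\}^n:\ \tfrac{1}{\sqrt n}\sum_{i=1}^n G_{j,i}X_i\ge\kappa\ \text{ for all } j=1,\dots,m\Big\}.$$ Two solutions are adjacent if they differ in exactly one coordinate. A cluster is a maximal connected component of $S(G)$ under this adjacency. The diameter of a cluster is the maximum Hamming distance between two of its elements. ''With high probability'' means with probability tending to $1$ as $n\to\infty$, with $\kappa,\alpha$ fixed. *)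

(* Defs.v *)
From HB Require Import structures.
From mathcomp Require Import all_boot all_order all_algebra.
From mathcomp Require Import all_classical all_reals all_analysis.
Set Implicit Arguments.
Unset Strict Implicit.
Unset Printing Implicit Defensive.
Import Order.TTheory GRing.Theory Num.Theory.
Import numFieldNormedType.Exports.

Local Open Scope ring_scope.

(* Elements of {-1,+1} are encoded by booleans, false for +1 and true for -1,
   so that sign matrices and sign vectors form finite types. *)
Definition sgn (R : realType) (b : bool) : R := (-1) ^+ b.

(* The law of one entry, and the product law it induces on m x n matrices
   (i.e. the joint law of m * n independent entries). *)
Definition entry_law (R : realType) (b : bool) : R := 2^-1.

Definition mx_law (R : realType) (m n : nat) (G : 'M[bool]_(m, n)) : R :=
  \prod_(j < m) \prod_(i < n) entry_law R (G j i).

Definition Pr (R : realType) (m n : nat) (E : pred 'M[bool]_(m, n)) : R :=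
  \sum_(G : 'M[bool]_(m, n) | E G) mx_law R G.

(* On nonnegative arguments, truncn is the floor, as a natural number. *)
Definition nrows (R : realType) (alpha : R) (n : nat) : nat :=
  Num.truncn (alpha * n%:R).

Definition whp (R : realType) (alpha : R)
    (E : forall n : nat, pred 'M[bool]_(nrows alpha n, n)) : Prop :=
  (Pr R (E n) @[n --> \oo] --> (1 : R))%classic.

Definition solutions (R : realType) (kappa : R) (m n : nat)
    (G : 'M[bool]_(m, n)) : {set {ffun 'I_n -> bool}} :=
  [set X : {ffun 'I_n -> bool} | [forall j : 'I_m,
    kappa <= (Num.sqrt n%:R)^-1 * \sum_(i < n) sgn R (G j i) * sgn R (X i)]].

Definition hamming (n : nat) (X Y : {ffun 'I_n -> bool}) : nat :=
  #|[set i | X i != Y i]|.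

Definition adjacent_in (n : nat) (S : {set {ffun 'I_n -> bool}}) :
    rel {ffun 'I_n -> bool} :=
  [rel X Y | [&& X \in S, Y \in S & hamming X Y == 1%N]].

(* The classes of S for the reflexive-transitive closure of adjacency in S. *)
Definition clusters (n : nat) (S : {set {ffun 'I_n -> bool}}) :
    {set {set {ffun 'I_n -> bool}}} :=
  equivalence_partition (connect (adjacent_in S)) S.

Definition diameter (n : nat) (C : {set {ffun 'I_n -> bool}}) : nat :=
  (\max_(X in C) \max_(Y in C) hamming X Y)%N.

Arguments whp {R} alpha E.

(* Main.v *)
(* A solution X for a slightly larger margin kappa' > kappa exists with high
   probability, by right continuity of alpha_c. The rest is deterministic. By
   discrepancy theory (Spencer's partial colouring method), for every set K of at
   most 2^(M-g) columns and at most 2^M rows with entries in [-1, 1] there are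
   signs whose signed sums over all prefixes of K are O(2^(M/2) (9/10)^g).
   Iterated halving gives a set K of proportion about 2^-g of the columns on which
   each row sum of (G_ji X_i) is about 2^-g times the whole row sum. Replacing X_i
   by X_i y_i on K, with y such a signing of K, and then flipping the coordinates
   of K one after the other keeps all row sums above kappa sqrt(n) when g is a
   large constant. So X y and its flip on K, at distance |K| >= 2^-(g+1) n, belong
   to the same cluster. *)
Require Import Defs.
From HB Require Import structures.
From mathcomp Require Import all_boot all_order all_algebra.
From mathcomp Require Import all_classical all_reals all_analysis.
From mathcomp Require Import ring lra zify.
Set Implicit Arguments.
Unset Strict Implicit.
Unset Printing Implicit Defensive.
Import Order.TTheory GRing.Theory Num.Theory.
Import numFieldNormedType.Exports.

Local Open Scope classical_set_scope.
Local Open Scope ring_scope.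

(** * Partial colouring by the pigeonhole principle *)

Lemma sgn_addb (R : realType) (b c : bool) : sgn R (b (+) c) = sgn R b * sgn R c.
Proof. by rewrite /sgn signr_addb. Qed.

Definition toggle (I : finType) (i : I) (Z : {ffun I -> bool}) : {ffun I -> bool} :=
  [ffun k => Z k (+) (k == i)].

Lemma toggleK (I : finType) (i : I) : involutive (toggle i).
Proof. by move=> Z; apply/ffunP => k; rewrite !ffunE addbK. Qed.

Lemma sum_toggle_odd (R : realType) (I : finType) (i : I)
    (h : {ffun I -> bool} -> R) :
  (forall Z, h (toggle i Z) = - h Z) -> \sum_Z h Z = 0.
Proof.
move=> hN; suff: \sum_Z h Z = - \sum_Z h Z by lra.
rewrite {1}(reindex_inj (inv_inj (toggleK i))) -sumrN.
by apply: eq_bigr => Z _; rewrite hN.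
Qed.

Lemma sum_sgn_toggle (R : realType) (I : finType) (i : I) (c : I -> R)
    (s : seq I) (Z : {ffun I -> bool}) : i \notin s ->
  \sum_(k <- s) c k * sgn R (toggle i Z k) = \sum_(k <- s) c k * sgn R (Z k).
Proof.
move=> iNs; rewrite !big_seq; apply: eq_bigr => k ks.
by rewrite ffunE; case: eqP ks iNs => [->->//|_ _ _]; rewrite addbF.
Qed.

(** Induction on the coordinates. Odd powers of the new sign cancel under [toggle], which leaves
    [c i ^+ 4 + 6 * c i ^+ 2 * Q + 3 * Q ^+ 2], at most [3 * (c i ^+ 2 + Q) ^+ 2]. The middle term
    is why the second moment is carried along. *)
Lemma fourth_moment_seq (R : realType) (I : finType) (c : I -> R) (s : seq I) :
  uniq s ->
  (\sum_(Z : {ffun I -> bool}) (\sum_(i <- s) c i * sgn R (Z i)) ^+ 2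
     = (\sum_(i <- s) c i ^+ 2) * 2 ^+ #|I|) /\
  (\sum_(Z : {ffun I -> bool}) (\sum_(i <- s) c i * sgn R (Z i)) ^+ 4
     <= 3 * (\sum_(i <- s) c i ^+ 2) ^+ 2 * 2 ^+ #|I|).
Proof.
have cst (x : R) : \sum_(Z : {ffun I -> bool}) x = x * 2 ^+ #|I|.
  by rewrite sumr_const card_ffun card_bool -(mulr_natr x (2 ^ _)) natrX.
elim: s => [_|i s IH /= /andP[iNs /IH[IH2 IH4]]].
  split; first by under eq_bigr do rewrite big_nil expr0n; rewrite big1 // big_nil mul0r.
  under eq_bigr do rewrite big_nil expr0n.
  by rewrite big1 // big_nil expr0n /= mulr0 mul0r.
set P := fun Z : {ffun I -> bool} => \sum_(k <- s) c k * sgn R (Z k).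
have odd_vanish (e : nat) (x : R) :
    \sum_(Z : {ffun I -> bool}) x * (sgn R (Z i) * P Z ^+ e) = 0.
  apply: (@sum_toggle_odd _ _ i) => Z; rewrite /P sum_sgn_toggle // ffunE eqxx.
  by rewrite sgn_addb /sgn expr1; ring.
set N : R := 2 ^+ #|I| in cst IH2 IH4 *.
have N0 : 0 <= N by rewrite exprn_ge0.
rewrite big_cons; set Q := \sum_(k <- s) c k ^+ 2 in IH2 IH4 *; split.
  transitivity (\sum_(Z : {ffun I -> bool})
      (c i ^+ 2 + 2 * c i * (sgn R (Z i) * P Z ^+ 1) + P Z ^+ 2)).
    apply: eq_bigr => Z _; rewrite big_cons -/(P Z).
    by case: (Z i); rewrite /sgn; ring.
  by rewrite !big_split /= odd_vanish cst IH2; ring.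
have -> : \sum_(Z : {ffun I -> bool}) (\sum_(k <- i :: s) c k * sgn R (Z k)) ^+ 4 =
   \sum_(Z : {ffun I -> bool}) (c i ^+ 4 + 4 * c i ^+ 3 * (sgn R (Z i) * P Z ^+ 1)
      + 6 * c i ^+ 2 * P Z ^+ 2 + 4 * c i * (sgn R (Z i) * P Z ^+ 3) + P Z ^+ 4).
  apply: eq_bigr => Z _; rewrite big_cons -/(P Z).
  by case: (Z i); rewrite /sgn; ring.
rewrite !big_split /= !odd_vanish cst -mulr_sumr IH2.
have Q0 : 0 <= Q by apply: sumr_ge0 => k _; exact: sqr_ge0.
have c4 : 0 <= c i ^+ 4 * N by rewrite mulr_ge0 // exprn_even_ge0.
apply: (le_trans (lerD (lexx _) IH4)).
rewrite -subr_ge0; apply: (le_trans (y := 2 * (c i ^+ 4 * N))); first by lra.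
by rewrite le_eqVlt; apply/orP; left; apply/eqP; ring.
Qed.

Lemma fourth_moment (R : realType) (I : finType) (c : I -> R) :
  \sum_(Z : {ffun I -> bool}) (\sum_i c i * sgn R (Z i)) ^+ 4
     <= 3 * (\sum_i c i ^+ 2) ^+ 2 * 2 ^+ #|I|.
Proof. exact: (fourth_moment_seq c (index_enum_uniq I)).2. Qed.

(* The integer nearest to [y], integers being encoded by naturals: [2k] for [k >= 0],
   [2k - 1] for [- k < 0]; the truncated predecessor gives [0] on [-1/2 < y < 0]. *)
Definition round_code (R : realType) (y : R) : nat :=
  if 0 <= y then (Num.truncn (y + 2^-1)).*2 else (Num.truncn (2^-1 - y)).*2.-1.

Lemma round_code_inj (R : realType) (x y : R) : round_code x = round_code y -> `|x - y| <= 1.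
Proof.
have tr (z : R) : 0 <= z -> exists2 k, Num.truncn (z + 2^-1) = k &
    k%:R - 2^-1 <= z < k%:R + 2^-1.
  move=> z0; exists (Num.truncn (z + 2^-1)) => //.
  have /truncn_itv/andP[] : 0 <= z + 2^-1 by lra.
  by rewrite -[(Num.truncn _).+1%:R]natr1 => a b; apply/andP; split; lra.
rewrite /round_code; case: leP => [x0|x0]; case: leP => [y0|y0].
- have [k -> /andP[? ?]] := tr _ x0; have [l -> /andP[? ?]] := tr _ y0.
  by move=> /double_inj kl; subst l; rewrite ler_norml; apply/andP; split; lra.
- have [k -> /andP[? ?]] := tr _ x0.
  have /tr[l]: 0 <= - y by lra.
  rewrite addrC => -> /andP[? ?] kl.
  have [k0 l0] : k = 0%N /\ l = 0%N by lia.
  by subst k l; rewrite ler_norml; apply/andP; split; lra.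
- have [k -> /andP[? ?]] := tr _ y0.
  have /tr[l]: 0 <= - x by lra.
  rewrite addrC => -> /andP[? ?] kl.
  have [k0 l0] : k = 0%N /\ l = 0%N by lia.
  by subst k l; rewrite ler_norml; apply/andP; split; lra.
- have /tr[k]: 0 <= - x by lra.
  rewrite addrC => -> /andP[? ?].
  have /tr[l]: 0 <= - y by lra.
  rewrite addrC => -> /andP[? ?] kl.
  have kl' : k = l \/ (k <= 1 /\ l <= 1 /\ k + l = 1)%N by lia.
  case: kl' => [kl'|[? [? ?]]]; first by subst l; rewrite ler_norml; apply/andP; split; lra.
  lia.
Qed.

(** The code is 0 when [|y| < 1/2]; otherwise it is at most [4 * |y|], and [|y| ^+ 3 >= 1/8]. The
    fourth power is chosen to match [fourth_moment]. *)
Lemma round_code_le (R : realType) (y : R) : (round_code y)%:R <= 32 * y ^+ 4.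
Proof.
have bound (z : R) : 0 <= z -> (Num.truncn (z + 2^-1)).*2%:R <= 32 * z ^+ 4.
  move=> z0; have /truncn_itv/andP[tr _] : 0 <= z + 2^-1 by lra.
  have [zl|zl] := ltP z 2^-1.
    have -> : Num.truncn (z + 2^-1) = 0%N.
      by apply/eqP; rewrite -leqn0 truncn_le_nat; lra.
    by rewrite mulr_ge0 // exprn_ge0.
  rewrite -muln2 natrM; apply: (le_trans (y := 4 * z)); first by lra.
  have z3 : 8^-1 <= z ^+ 3.
    have -> : 8^-1 = 2^-1 ^+ 3 :> R by field.
    by rewrite lerXn2r // nnegrE; lra.
  by rewrite (exprSr _ 3); nra.
rewrite /round_code; case: (leP 0 y) => y0; first exact: bound.
have := bound (- y); rewrite exprNn -signr_odd expr0 mul1r addrC => b.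
by apply: le_trans (b _); [rewrite ler_nat leq_pred|lra].
Qed.

Lemma sum_geometric_le (R : realType) (x : R) (n : nat) :
  0 <= x < 1 -> \sum_(k < n) x ^+ k <= (1 - x)^-1.
Proof.
move=> /andP[x0 x1]; rewrite -[leRHS]mul1r ler_pdivlMr ?subr_gt0 // mulrC.
have := subrXX 1 x n; rewrite expr1n.
under eq_bigr do rewrite expr1n mul1r.
by move=> <-; have := exprn_ge0 n x0; lra.
Qed.

(** The weight factorises over coordinates: each one in [U] contributes [1 + x], each other one
    [2]. *)
Lemma sum_hamming_weight (R : realType) (I : finType) (U : {set I})
    (Z : {ffun I -> bool}) (x : R) :
  \sum_(Y : {ffun I -> bool}) x ^+ #|[set i in U | Z i != Y i]|
    = 2 ^+ #|I| * ((1 + x) / 2) ^+ #|U|.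
Proof.
pose F (i : I) (b : bool) := if (i \in U) && (Z i != b) then x else 1.
have -> : \sum_(Y : {ffun I -> bool}) x ^+ #|[set i in U | Z i != Y i]|
    = \sum_(Y : {ffun I -> bool}) \prod_i F i (Y i).
  apply: eq_bigr => Y _; rewrite -big_mkcond /= prodr_const.
  by congr (_ ^+ _); apply: eq_card => i; rewrite !inE.
rewrite -(bigA_distr_bigA F).
have -> : \prod_i \sum_b F i b = \prod_i (2 * if i \in U then (1 + x) / 2 else 1).
  apply: eq_bigr => i _; rewrite big_bool /F.
  by case: (i \in U); case: (Z i) => /=; field.
by rewrite big_split /= prodr_const -big_mkcond /= prodr_const.
Qed.

(* Markov's inequality for [y ^+ (4 * distance)] with [y = 3/4]. *)
Lemma card_near_le (R : realType) (I : finType) (U : {set I})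
    (Z : {ffun I -> bool}) (A : {set {ffun I -> bool}}) :
  (forall Y, Y \in A -> (4 * #|[set i in U | Z i != Y i]| < #|U|)%N) ->
  #|A|%:R <= 2 ^+ #|I| * (337 / 384) ^+ #|U| :> R.
Proof.
move=> near.
have y0 : 0 < (3 / 4) ^+ #|U| :> R by rewrite exprn_gt0 //; lra.
rewrite -(ler_pM2r y0).
(* [337/384] is [(1 + (3/4)^4) / 2 = 337/512] divided by [3/4]. *)
have -> : 2 ^+ #|I| * (337 / 384) ^+ #|U| * (3 / 4) ^+ #|U|
    = 2 ^+ #|I| * ((1 + (3 / 4) ^+ 4) / 2) ^+ #|U| :> R.
  by rewrite -mulrA -exprMn; congr (_ * _ ^+ _); field.
rewrite -(sum_hamming_weight U Z) mulrC mulr_natr -sumr_const big_mkcond /=.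
apply: ler_sum => Y _; case: ifP => [/near YA|_]; last first.
  by rewrite exprn_ge0 // exprn_ge0 //; lra.
by rewrite -exprM; apply: ler_wiXn2l (ltnW YA); lra.
Qed.

Lemma expRN_nat_le (R : realType) (c : nat) : expR (- c%:R) <= 2^-1 ^+ c :> R.
Proof.
rewrite -mulrN1 expRM_natl lerXn2r ?nnegrE ?expR_ge0 //.
by rewrite expRN lef_pV2 ?posrE ?expR_gt0 //; have := expR_ge1Dx (1 : R); lra.
Qed.

(** Jensen's inequality from the tangent line of the exponential at [- V]. *)
Lemma sum_jensen_expRN (R : realType) (T : finType) (W : T -> R) (V : R) :
  \sum_z W z <= V * #|T|%:R -> #|T|%:R * expR (- V) <= \sum_z expR (- W z).
Proof.
move=> WV.
apply: (le_trans (y := \sum_z expR (- V) * (1 + (V - W z)))); last first.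
  apply: ler_sum => z _; rewrite (_ : expR (- W z) = expR (- V) * expR (V - W z)).
    by rewrite ler_pM2l ?expR_gt0 // expR_ge1Dx.
  by rewrite -expRD; congr expR; ring.
rewrite -mulr_sumr mulrC ler_pM2l ?expR_gt0 //.
rewrite big_split /= sumrB !sumr_const.
rewrite -[V *+ _]mulr_natr; lra.
Qed.

(* The pigeons are the sign vectors [Z], the holes the vectors of rounded values
   of the linear forms [f t]. A hole is weighted by the product of
   [expR (- c t * round_code)]: the total weight of the holes is close to 1,
   while by Jensen's inequality the average weight of a pigeon's hole is not much
   smaller than 1. So some hole holds too many pigeons for a Hamming ball. *)
Lemma close_distant_pair (R : realType) (I T : finType) (f : T -> I -> R)
    (Delta : T -> R) (c : T -> nat) (U : {set I}) :
  (0 < #|U|)%N -> (forall t, 0 < Delta t) -> (forall t, (0 < c t)%N) ->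
  \sum_t (2 * 2^-1 ^+ c t
          + 96 * (c t)%:R * (\sum_i f t i ^+ 2) ^+ 2 / Delta t ^+ 4)
    <= #|U|%:R / 10 ->
  exists Y Z : {ffun I -> bool},
    (forall t, `|\sum_i f t i * sgn R (Y i) - \sum_i f t i * sgn R (Z i)| <= Delta t)
    /\ (#|U| <= 4 * #|[set i in U | Y i != Z i]|)%N.
Proof.
move=> U0 D0 c0 cost; apply: contrapT => no_pair.
pose F t (Z : {ffun I -> bool}) := \sum_i f t i * sgn R (Z i).
pose k t Z := round_code (F t Z / Delta t).
pose N := (\max_Z \max_t k t Z)%N.
pose p (Z : {ffun I -> bool}) : {ffun T -> 'I_N.+1} := [ffun t => inord (k t Z)].
have pE t Z : p Z t = k t Z :> nat.
  rewrite ffunE inordK // ltnS.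
  apply: leq_trans (leq_bigmax Z); exact: (leq_bigmax t).
have near Y Z : p Z = p Y -> (4 * #|[set i in U | Y i != Z i]| < #|U|)%N.
  move=> pYZ; rewrite ltnNge; apply/negP => far; apply: no_pair; exists Y, Z.
  split=> // t; have := pE t Y; rewrite -pYZ pE => /round_code_inj.
  rewrite -mulrBl normrM normfV (gtr0_norm (D0 t)) ler_pdivrMr // mul1r.
  by rewrite distrC.
pose s : R := 2 ^+ #|I| * (337 / 384) ^+ #|U|.
have s0 : 0 <= s by apply: mulr_ge0; apply: exprn_ge0; lra.
pose V : R := \sum_t 96 * (c t)%:R * (\sum_i f t i ^+ 2) ^+ 2 / Delta t ^+ 4.
pose Q : R := \sum_t 2 * 2^-1 ^+ c t.
pose W Z : R := \sum_t (c t)%:R * (k t Z)%:R.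
have cardE : #|{ffun I -> bool}|%:R = 2 ^+ #|I| :> R.
  by rewrite card_ffun card_bool natrX.
have lower : 2 ^+ #|I| * expR (- V) <= \sum_Z expR (- W Z).
  rewrite -cardE; apply: sum_jensen_expRN; rewrite cardE exchange_big /= mulr_suml.
  apply: ler_sum => t _; rewrite -mulr_sumr.
  (* The factor 32 of the rounding bound and the 3 of the fourth moment give the 96 in [V]. *)
  apply: (le_trans (y := (c t)%:R * \sum_Z 32 * (F t Z / Delta t) ^+ 4)).
    by rewrite ler_wpM2l //; apply: ler_sum => Z _; exact: round_code_le.
  rewrite -mulr_sumr; under eq_bigr do rewrite exprMn.
  rewrite -mulr_suml exprVn.
  have D4 : 0 <= (Delta t ^+ 4)^-1 by rewrite invr_ge0 exprn_ge0 // ltW.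
  have := ler_wpM2r D4 (fourth_moment (f t)).
  by move/(ler_wpM2l (_ : 0 <= 32 * (c t)%:R)) => /(_ ltac:(by rewrite mulr_ge0)); lra.
have upper : \sum_Z expR (- W Z) <= s * expR Q.
  pose w (b : {ffun T -> 'I_N.+1}) := \prod_t expR (- (c t)%:R) ^+ b t : R.
  have w0 b : 0 <= w b by apply: prodr_ge0 => t _; rewrite exprn_ge0 // expR_ge0.
  have -> : \sum_Z expR (- W Z) = \sum_Z w (p Z).
    apply: eq_bigr => Z _; rewrite -sumrN expR_sum; apply: eq_bigr => t _.
    by rewrite pE -expRM_natl mulrN mulrC.
  (* Group the pigeons by hole. Two pigeons in one hole are close on [U], so [card_near_le] allows
     at most [s] of them. *)
  rewrite (partition_big p predT) //=.
  apply: (le_trans (y := \sum_b s * w b)).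
    apply: ler_sum => b _.
    have [Z /= /eqP pZ|none] := pickP (fun Z => p Z == b); last first.
      rewrite big1 => [|Z]; last by rewrite none.
      exact: mulr_ge0 s0 (w0 b).
    rewrite (eq_bigr (fun=> w b)); last by move=> Y /eqP ->.
    rewrite sumr_const -mulr_natl ler_wpM2r //.
    rewrite -cardsE; apply: (@card_near_le _ _ _ Z) => Y; rewrite finset.inE => pY.
    by apply: near; rewrite pZ; apply/eqP; exact: pY.
  rewrite -mulr_sumr ler_wpM2l //.
  (* The total weight of all holes is a product of geometric sums, each at most [1 / (1 - x)] with
     [x <= 2^-1 ^+ c t <= 1/2], hence at most [1 + 2 * 2^-1 ^+ c t]. *)
  rewrite -(bigA_distr_bigA (fun t (j : 'I_N.+1) => expR (- (c t)%:R) ^+ j)).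
  rewrite /Q expR_sum; apply: ler_prod => t _; apply/andP; split.
    by apply: sumr_ge0 => j _; rewrite exprn_ge0 // expR_ge0.
  have x2 := expRN_nat_le R (c t).
  have h2 : 2^-1 ^+ c t <= 2^-1 :> R.
    by rewrite -[leRHS]expr1 ler_wiXn2l ?c0 //; lra.
  have x0 : 0 <= expR (- (c t)%:R) :> R by exact: expR_ge0.
  apply: (le_trans (sum_geometric_le _ _)); first by lra.
  apply: le_trans (expR_ge1Dx _).
  by rewrite -[leLHS]mul1r ler_pdivrMr; [nra|lra].
have N2 : 0 < 2 ^+ #|I| :> R by rewrite exprn_gt0.
have := le_trans lower upper; rewrite /s -mulrA ler_pM2l // => contra.
(* This is absurd, since [exp(-1/10) >= 9/10 > 337/384] and [U] is nonempty. *)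
have : expR (- (#|U|%:R / 10)) <= (337 / 384) ^+ #|U| :> R.
  apply: (le_trans (y := expR (- V - Q))).
    by rewrite ler_expR; move: cost; rewrite big_split /= -/V -/Q; lra.
  by rewrite expRD (expRN Q) ler_pdivrMr ?expR_gt0.
apply/negP; rewrite -ltNge.
rewrite -mulrN expRM_natl ltrXn2r -?lt0n.
- exact: U0.
- by lra.
- by have := expR_ge1Dx (- 10^-1 : R); lra.
Qed.

(** * Signings with small prefix sums *)

(** For [i] in [U], [rank U i] is the position of [i], counted from 0, in the increasing enumeration
    of [U]; its quotient by [L] numbers the consecutive blocks of length [L]. *)
Definition rank (n : nat) (U : {set 'I_n}) (t : nat) : nat :=
  #|[set i in U | (i < t)%N]|.

Lemma rank_le (n : nat) (U : {set 'I_n}) (t : nat) : (rank U t <= #|U|)%N.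
Proof. by apply/subset_leq_card/fintype.subsetP => i; rewrite finset.inE => /andP[]. Qed.

Lemma rank_ltE (n : nat) (U : {set 'I_n}) (i : 'I_n) (t : nat) :
  i \in U -> (rank U i < rank U t)%N = (i < t)%N.
Proof.
move=> iU; have [it|ti] := ltnP i t; last first.
  apply/negbTE; rewrite -leqNgt; apply/subset_leq_card/fintype.subsetP => k.
  by rewrite !finset.inE => /andP[-> /leq_trans->].
apply/proper_card/fintype.properP; split.
  by apply/fintype.subsetP => k; rewrite !finset.inE => /andP[-> /ltn_trans->].
by exists i; rewrite !finset.inE iU ?it // ltnn.
Qed.

Lemma card_rank_block (n : nat) (U : {set 'I_n}) (L q : nat) : (0 < L)%N ->
  (#|[set i in U | (rank U i %/ L == q)%N]| <= L)%N.
Proof.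
case: L => // L _; rewrite -[leqRHS]card_ord.
apply: (@fintype.leq_card_in _ _ (fun i : 'I_n => inord (rank U i %% L.+1) : 'I_L.+1)).
move=> i k; rewrite !finset.inE => /andP[iU /eqP iq] /andP[kU /eqP kq].
move=> /(congr1 val); rewrite /= !inordK ?ltn_mod // => ik.
have rik : rank U i = rank U k.
  by rewrite (divn_eq (rank U i) L.+1) (divn_eq (rank U k) L.+1) iq kq ik.
have := rank_ltE i kU; have := rank_ltE k iU.
by rewrite rik ltnn => ik' ki'; apply/val_inj => /=; lia.
Qed.

(* A prefix of [U] is a disjoint union of dyadic blocks, one at most for each size. *)
Lemma prefix_le_dyadic (R : realType) (n : nat) (U : {set 'I_n})
    (h : 'I_n -> R) (S : nat) (e : nat -> R) :
  (#|U| <= 2 ^ S)%N ->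
  (forall s q, (s <= S)%N -> (q < 2 ^ s)%N ->
     `|\sum_(i in U | (rank U i %/ 2 ^ (S - s) == q)%N) h i| <= e s) ->
  forall t, `|\sum_(i in U | (i < t)%N) h i| <= \sum_(s < S.+1) e s.
Proof.
move=> US block t.
pose G r := \sum_(i in U | (rank U i < r)%N) h i.
have -> : \sum_(i in U | (i < t)%N) h i = G (rank U t).
  rewrite /G big_mkcondr [RHS]big_mkcondr; apply: eq_bigr => i iU.
  by rewrite rank_ltE.
have G0 : G 0%N = 0 by rewrite /G big1 // => i /andP[].
have GD q L : (0 < L)%N ->
    G (q.+1 * L)%N = G (q * L)%N + \sum_(i in U | (rank U i %/ L == q)%N) h i.
  move=> L0; rewrite /G (bigID (fun i : 'I_n => (rank U i < q * L)%N)) /=.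
  congr (_ + _); apply: eq_bigl => i.
    rewrite -andbA; congr (_ && _); apply/andP/idP => [[]//|lt]; split=> //.
    by apply: leq_trans lt _; rewrite leq_mul2r leqnSn orbT.
  by rewrite -andbA -ltn_divLR // -ltn_divLR // ltnS -leqNgt -eqn_leq.
have e0 s : (s <= S)%N -> 0 <= e s.
  by move=> sS; apply: le_trans (block s 0%N sS _); rewrite ?expn_gt0.
have main s : (s <= S)%N -> forall q, (q <= 2 ^ s)%N ->
    `|G (q * 2 ^ (S - s))%N| <= \sum_(u < s.+1) e u.
  elim: s => [_ [|[|//]] _|s IH sS q qs].
  - by rewrite mul0n G0 normr0 big_ord1 e0.
  - by rewrite GD ?expn_gt0 // mul0n G0 add0r big_ord1 block.
  (* A prefix of [q] blocks of level [s.+1] is a prefix of [q./2] blocks of level [s], followed by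
     one more block when [q] is odd. *)
  have even (q' : nat) : (q'.*2 * 2 ^ (S - s.+1) = q' * 2 ^ (S - s))%N.
    by rewrite subnS -muln2 -mulnA -expnS prednK // subn_gt0.
  rewrite big_ord_recr /= -(odd_double_half q).
  have q2 : (q./2 <= 2 ^ s)%N.
    by rewrite -leq_double -(leq_add2l (odd q)) odd_double_half; move: qs; rewrite expnS; lia.
  have := IH (ltnW sS) _ q2; rewrite -even => IHq.
  case oq : (odd q); last by rewrite add0n (le_trans IHq) // lerDl e0.
  rewrite add1n GD ?expn_gt0 //; apply: (le_trans (ler_normD _ _)).
  apply: lerD IHq (block _ _ sS _).
  by move: qs; rewrite -{1}(odd_double_half q) oq.
by have := main S (leqnn S) (rank U t) (leq_trans (rank_le U t) US); rewrite subnn muln1.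
Qed.

(* [39 / 100] is an upper bound of [(4 * (9 / 10) ^+ 4)^-1]. *)
Lemma dyadic_level_cost (R : realType) (u : nat) :
  2 ^+ u * (2 * 2^-1 ^+ (10 + 2 * u)
    + 96 * (10 + 2 * u)%:R * (39 / 100) ^+ u / 30 ^+ 4)
  <= (500)^-1 * 2^-1 ^+ u + (800)^-1 * (19 / 20) ^+ u :> R.
Proof.
rewrite mulrDr; apply: lerD.
  have -> : 2 ^+ u * (2 * 2^-1 ^+ (10 + 2 * u)) = 2 * 2^-1 ^+ 10 * 2^-1 ^+ u :> R.
    have : (2 : R) ^+ u * 2^-1 ^+ u = 1 by rewrite -exprMn divff // expr1n.
    rewrite exprD exprM [2^-1 ^+ 2]expr2 exprMn.
    move: (2 ^+ u) (2^-1 ^+ u) (2^-1 ^+ 10) => p q r pq.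
    by rewrite -[RHS]mulr1 -pq; ring.
  by rewrite ler_pM2r ?exprn_gt0 //; lra.
(* The linear factor is traded for a geometric one mild enough that [2 * (6/5) * (39/100) = 0.936]
   stays below [19/20]. *)
have bern : (10 + 2 * u)%:R <= 10 * (6 / 5) ^+ u :> R.
  elim: u => [|u IH]; first by rewrite expr0; lra.
  have -> : (10 + 2 * u.+1)%:R = (10 + 2 * u)%:R + 2 :> R.
    by rewrite -natrD; congr (_%:R); lia.
  rewrite exprS; have : 1 <= (6 / 5) ^+ u :> R by rewrite exprn_ege1 //; lra.
  by lra.
have z0 : 0 <= (39 / 100) ^+ u :> R by apply: exprn_ge0; lra.
have t0 : 0 <= 2 ^+ u :> R by rewrite exprn_ge0.
have h : 2 ^+ u * ((10 + 2 * u)%:R * (39 / 100) ^+ u) <= 10 * (19 / 20) ^+ u :> R.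
  apply: (le_trans (y := 2 ^+ u * (10 * (6 / 5) ^+ u * (39 / 100) ^+ u))).
    by rewrite ler_wpM2l // ler_wpM2r.
  have -> : 2 ^+ u * (10 * (6 / 5) ^+ u * (39 / 100) ^+ u)
     = 10 * (2 * (6 / 5) * (39 / 100)) ^+ u :> R by rewrite !exprMn; ring.
  by rewrite ler_pM2l // lerXn2r ?nnegrE; lra.
by have : 0 <= (19 / 20) ^+ u :> R; [apply: exprn_ge0; lra|lra].
Qed.

(** The pair lemma, applied to the sums of all rows over all dyadic blocks of [U], gives [Y] and
    [Z]. Half their difference is a partial colouring: it is 0 on the set [V] where they agree and
    equals [Y] on the rest of [U]. *)
Lemma prefix_partial_coloring (R : realType) (n : nat) (J : finType)
    (a : J -> 'I_n -> R) (U : {set 'I_n}) (M S g : nat) :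
  (forall j i, `|a j i| <= 1) -> (#|J| <= 2 ^ M)%N -> (S + g = M)%N ->
  (#|U| <= 2 ^ S < 2 * #|U|)%N ->
  exists (y : 'I_n -> bool) (V : {set 'I_n}),
    [/\ V \subset U, (4 * #|V| <= 3 * #|U|)%N &
      forall j t, `|\sum_(i in U :\: V | (i < t)%N) a j i * sgn R (y i)|
        <= 150 * Num.sqrt (2 ^+ M) * (9 / 10) ^+ g].
Proof.
move=> a1 JM SgM /andP[US SU].
set B := Num.sqrt (2 ^+ M).
have B0 : 0 < B by rewrite sqrtr_gt0 exprn_gt0.
have BB : B ^+ 2 = 2 ^+ M by rewrite sqr_sqrtr ?exprn_ge0.
have U0 : (0 < #|U|)%N by case: #|U| SU.
(* A row together with a dyadic block: level [s] has [2 ^ s] blocks of at most [2 ^ (S - s)]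
   elements. *)
pose T := (J * {s : 'I_S.+1 & 'I_(2 ^ s)})%type.
pose lev (t : T) : nat := tag t.2.
pose inblock (s q : nat) (i : 'I_n) := (rank U i %/ 2 ^ (S - s) == q)%N.
pose f (t : T) (i : 'I_n) : R :=
  if (i \in U) && inblock (lev t) (tagged t.2) i then a t.1 i else 0.
(* With [u = g + s], a block sum at level [s] has standard deviation at most [B * 2^(-u/2)]. The
   tolerance decays more slowly, so costs shrink with [u], yet fast enough for the tolerances to be
   summable. *)
pose D s := 30 * B * (9 / 10) ^+ (g + s).
have D0 s : 0 < D s by rewrite !mulr_gt0 // exprn_gt0 //; lra.
pose c (t : T) := (10 + 2 * (g + lev t))%N.
have f2 t : \sum_i f t i ^+ 2 <= 2 ^+ (S - lev t).
  apply: (le_trans (y := \sum_(i in U | inblock (lev t) (tagged t.2) i) 1)).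
    rewrite [leRHS]big_mkcond /=; apply: ler_sum => i _; rewrite /f.
    case: ifP => _; last by rewrite expr0n.
    by rewrite -real_normK ?num_real // expr_le1.
  rewrite sumr_const -natrX ler_nat -cardsE.
  by apply: card_rank_block; rewrite expn_gt0.
have fsum0 t : 0 <= \sum_i f t i ^+ 2 by apply: sumr_ge0 => i _; exact: sqr_ge0.
pose K u : R := 2 * 2^-1 ^+ (10 + 2 * u)
    + 96 * (10 + 2 * u)%:R * (39 / 100) ^+ u / 30 ^+ 4.
have costK (t : T) : 2 * 2^-1 ^+ c t
    + 96 * (c t)%:R * (\sum_i f t i ^+ 2) ^+ 2 / D (lev t) ^+ 4 <= K (g + lev t)%N.
  suff : (\sum_i f t i ^+ 2) ^+ 2 / D (lev t) ^+ 4
      <= (39 / 100) ^+ (g + lev t) / 30 ^+ 4.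
    move=> key; apply: lerD; first exact: lexx.
    rewrite -[leLHS]mulrA -[leRHS]mulrA; apply: ler_wpM2l key.
    by apply: mulr_ge0; exact: ler0n.
  rewrite ler_pdivrMr ?exprn_gt0 // /D; set u := (g + lev t)%N.
  have levS : (lev t <= S)%N by rewrite -ltnS /lev ltn_ord.
  have p0 : 0 < 2 ^+ u :> R by rewrite exprn_gt0.
  apply: (le_trans (y := (B ^+ 2 / 2 ^+ u) ^+ 2)).
    rewrite BB; apply: lerXn2r; rewrite ?nnegrE ?divr_ge0 ?exprn_ge0 ?fsum0 //.
    apply: (le_trans (f2 t)); rewrite ler_pdivlMr // -exprD.
    by rewrite (_ : (S - lev t + u)%N = M) // /u; lia.
  rewrite (_ : (B ^+ 2 / 2 ^+ u) ^+ 2 = B ^+ 4 * (2^-1 ^+ 2) ^+ u); last first.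
    by rewrite exprMn -(exprM B) -exprVn (exprAC (2^-1)); congr (_ * _).
  rewrite (_ : (39 / 100) ^+ u / _ * _ = B ^+ 4 * (39 / 100 * (9 / 10) ^+ 4) ^+ u).
    apply: ler_wpM2l; first exact/exprn_ge0/ltW.
    by apply: lerXn2r; rewrite ?nnegrE; lra.
  rewrite (exprMn 4 (30 * B)) (exprMn 4 30 B) (exprMn u (39 / 100)) (exprAC (9 / 10)).
  by field.
have total : \sum_t (2 * 2^-1 ^+ c t
    + 96 * (c t)%:R * (\sum_i f t i ^+ 2) ^+ 2 / D (lev t) ^+ 4) <= #|U|%:R / 10.
  apply: le_trans (ler_sum _ (fun t _ => costK t)) _.
  (* As [#|J| <= 2 ^ (S + g)], the blocks of level [s] number at most [2 ^ S * 2 ^ (g + s)] over all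
     rows: the cost depends on [g + s] only, up to [2 ^ S < 2 * #|U|]. *)
  have -> : \sum_(t : T) K (g + lev t)%N
      = #|J|%:R * \sum_(s < S.+1) 2 ^+ s * K (g + s)%N.
    rewrite -(pair_bigA _ (fun (_ : J) (p : {s : 'I_S.+1 & 'I_(2 ^ s)}) =>
      K (g + tag p)%N)) /= sumr_const -[LHS]mulr_natl.
    congr (_ * _).
    rewrite -(sig_big_dep xpredT (fun s => xpredT)
      (fun (s : 'I_S.+1) (q : 'I_(2 ^ s)) => K (g + s)%N)) /=.
    apply: eq_bigr => s _.
    by rewrite sumr_const card_ord -[LHS]mulr_natl natrX.
  have K0 u : 0 <= K u.
    apply: addr_ge0; first by rewrite mulr_ge0 // exprn_ge0 //; lra.
    apply: divr_ge0; last exact/exprn_ge0/ler0n.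
    by apply: mulr_ge0; [apply: mulr_ge0; exact: ler0n|apply: exprn_ge0; lra].
  apply: (le_trans (y := 2 ^+ S * \sum_(s < S.+1) 2 ^+ (g + s) * K (g + s)%N)).
    rewrite (mulr_sumr _ _ _ (2 ^+ S)) mulr_sumr; apply: ler_sum => s _.
    rewrite exprD !mulrA -exprD SgM ler_wpM2r // ler_wpM2r ?exprn_ge0 //.
    by rewrite -natrX ler_nat.
  have UR : 2 ^+ S <= 2 * #|U|%:R :> R.
    by rewrite -natrX -natrM ler_nat ltnW.
  suff : \sum_(s < S.+1) 2 ^+ (g + s) * K (g + s)%N <= 20^-1.
    have : 0 < 2 ^+ S :> R by rewrite exprn_gt0.
    move: (2 ^+ S) UR => p UR p0; move: (\sum_(s < _) _) => q q20.
    have : p * q <= p * 20^-1 by rewrite ler_pM2l.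
    lra.
  apply: (le_trans (y := \sum_(s < S.+1)
      ((500)^-1 * 2^-1 ^+ s + (800)^-1 * (19 / 20) ^+ s))).
    apply: ler_sum => s _; apply: le_trans (dyadic_level_cost R _) _.
    by apply: lerD; apply: ler_wpM2l; rewrite ?invr_ge0 ?ler0n //;
      apply: ler_wiXn2l (leq_addl _ _); lra.
  rewrite big_split /= -!mulr_sumr.
  have g1 : \sum_(s < S.+1) (2^-1 : R) ^+ s <= 2.
    by apply: le_trans (sum_geometric_le _ _) _; [lra|rewrite invf_ple ?posrE; lra].
  have g2 : \sum_(s < S.+1) (19 / 20 : R) ^+ s <= 20.
    by apply: le_trans (sum_geometric_le _ _) _; [lra|rewrite invf_ple ?posrE; lra].
  lra.
have [Y [Z [YZ far]]] := close_distant_pair U0 (fun t : T => D0 (lev t))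
   (fun t : T => isT : (0 < c t)%N) total.
exists Y, [set i in U | Y i == Z i]; split.
- by apply/fintype.subsetP => i; rewrite finset.inE => /andP[].
- have cardU : (#|[set i in U | Y i == Z i]| + #|[set i in U | Y i != Z i]| = #|U|)%N.
    rewrite -(cardsID [set i | Y i == Z i] U); congr (_ + _)%N; apply: eq_card => i;
    by rewrite !finset.inE // andbC.
  move: far; rewrite -cardU; move: #|_| #|_| => p q; lia.
move=> j t.
(* On [U], [h] is half of the difference of the [Y] and [Z] terms, whence the tolerance [D s / 2]
   per block. Summing [15 * (9/10)^s] over the levels gives the constant 150. *)
pose h i := if i \in [set i in U | Y i == Z i] then 0 else a j i * sgn R (Y i).
rewrite (_ : \sum_(i in _ | _) _ = \sum_(i in U | (i < t)%N) h i); last first.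
  rewrite big_mkcond [RHS]big_mkcond /=; apply: eq_bigr => i _.
  rewrite /h !finset.inE; case: (i \in U); case: (Y i == Z i) => //=.
  by case: ifP.
apply: le_trans (prefix_le_dyadic (e := fun s => D s / 2) US _ t) _.
  move=> s q; rewrite -ltnS => sS qs.
  pose T0 : T :=
    (j, Tagged (fun s : 'I_S.+1 => 'I_(2 ^ s)) (Ordinal qs : 'I_(2 ^ Ordinal sS))).
  have := YZ T0; rewrite -sumrB.
  rewrite (_ : \sum_i _ = 2 * \sum_(i in U | inblock s q i) h i).
    by rewrite normrM ger0_norm // ler_pdivlMr // mulrC.
  rewrite mulr_sumr [RHS]big_mkcond; apply: eq_bigr => i _.
  rewrite /f /h !finset.inE -[lev T0]/s -[tagged T0.2 : nat]/q /=.
  case: (i \in U) => /=; last by rewrite !mul0r subr0.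
  case: ifP => _; last by rewrite !mul0r subr0.
  by case: (Y i); case: (Z i) => /=; rewrite /sgn; ring.
rewrite -mulr_suml /D -mulr_sumr; under eq_bigr do rewrite exprD.
rewrite -mulr_sumr.
have g3 : \sum_(s < S.+1) (9 / 10 : R) ^+ s <= 10.
  by apply: le_trans (sum_geometric_le _ _) _; [lra|rewrite invf_ple ?posrE; lra].
have Bg : 0 < B * (9 / 10) ^+ g by rewrite mulr_gt0 // exprn_gt0 //; lra.
move: g3; rewrite -(ler_pM2l Bg); lra.
Qed.

Lemma merge_prefix_colorings (R : realType) (n : nat) (J : finType)
    (a : J -> 'I_n -> R) (U V W : {set 'I_n}) (y z : 'I_n -> bool) (e e' : R) :
  V \subset U -> W \subset V ->
  (forall j t, `|\sum_(i in U :\: V | (i < t)%N) a j i * sgn R (y i)| <= e) ->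
  (forall j t, `|\sum_(i in V :\: W | (i < t)%N) a j i * sgn R (z i)| <= e') ->
  forall j t, `|\sum_(i in U :\: W | (i < t)%N)
     a j i * sgn R (if i \in V then z i else y i)| <= e + e'.
Proof.
move=> /fintype.subsetP VU /fintype.subsetP WV ye ze j t.
rewrite (bigID (fun i => i \in V)) /= addrC.
apply: le_trans (ler_normD _ _) (lerD _ _).
  apply: le_trans (ye j t); rewrite le_eqVlt; apply/orP; left; apply/eqP; congr `|_|.
  apply: eq_big => [i|i /andP[_ /negbTE ->] //].
  rewrite !finset.inE; have := WV i; have := VU i.
  case: (i \in U); case: (i \in V); case: (i \in W) => //= h1 h2;
    rewrite ?andbF ?andbT //; by [have := h1 isT|have := h2 isT].
apply: le_trans (ze j t); rewrite le_eqVlt; apply/orP; left; apply/eqP; congr `|_|.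
apply: eq_big => [i|i /andP[_ ->] //].
rewrite !finset.inE; have := VU i.
by case: (i \in U); case: (i \in V); case: (i \in W) => //= h1;
  rewrite ?andbF ?andbT //; have := h1 isT.
Qed.

(** Three partial colourings suffice, because [(3/4)^3 < 1/2], and they cost [3 * 150 = 450]. The
    rounds stop early once at most [2 ^ S / 2] elements remain, where the lower bound on the size
    needed for another round fails. *)
Lemma half_prefix_coloring (R : realType) (n : nat) (J : finType)
    (a : J -> 'I_n -> R) (U : {set 'I_n}) (M S g : nat) :
  (forall j i, `|a j i| <= 1) -> (#|J| <= 2 ^ M)%N -> (S + g = M)%N ->
  (#|U| <= 2 ^ S)%N ->
  exists (y : 'I_n -> bool) (V : {set 'I_n}),
    [/\ V \subset U, (2 * #|V| <= 2 ^ S)%N &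
      forall j t, `|\sum_(i in U :\: V | (i < t)%N) a j i * sgn R (y i)|
        <= 450 * Num.sqrt (2 ^+ M) * (9 / 10) ^+ g].
Proof.
move=> a1 JM SgM US.
pose E : R := Num.sqrt (2 ^+ M) * (9 / 10) ^+ g.
have E0 : 0 <= E.
  by apply: mulr_ge0; [exact: sqrtr_ge0|apply: exprn_ge0; lra].
suff step r : exists (y : 'I_n -> bool) (V : {set 'I_n}),
    [/\ V \subset U, (2 * #|V| <= 2 ^ S)%N || (4 ^ r * #|V| <= 3 ^ r * 2 ^ S)%N &
      forall j t, `|\sum_(i in U :\: V | (i < t)%N) a j i * sgn R (y i)|
        <= r%:R * (150 * E)].
  have [y [V [VU small yV]]] := step 3; exists y, V; split=> //.
    by case/orP: small => // small; move: small; rewrite !expnS !expn0; lia.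
  move=> j t; apply: le_trans (yV j t) _.
  by rewrite -mulrA -/E; lra.
elim: r => [|r [y [V [VU small yV]]]]; last have rS : r.+1%:R = r%:R + 1 :> R by rewrite natr1.
  exists (fun=> false), U; split=> //; first by rewrite !mul1n US orbT.
  by move=> j t; rewrite finset.setDv big1 ?normr0 ?mul0r // => i; rewrite finset.inE.
have [VS|VS] := leqP (2 * #|V|) (2 ^ S).
  exists y, V; split=> //; first by rewrite VS.
  move=> j t; apply: le_trans (yV j t) _; rewrite rS; lra.
move: small; rewrite leqNgt VS /= => small.
have VS' : (#|V| <= 2 ^ S < 2 * #|V|)%N.
  by rewrite VS andbT (leq_trans (subset_leq_card VU)).
have [z [W [WV WV4 zW]]] := prefix_partial_coloring a1 JM SgM VS'.
exists (fun i => if i \in V then z i else y i), W; split.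
- exact: fintype.subset_trans WV VU.
- apply/orP; right; rewrite !expnS.
  have : (4 ^ r * (4 * #|W|) <= 4 ^ r * (3 * #|V|))%N by rewrite leq_mul2l WV4 orbT.
  by move: small; move: (4 ^ r)%N (3 ^ r)%N (2 ^ S)%N #|V| #|W| => p q s v w; nia.
- move=> j t; apply: le_trans (merge_prefix_colorings VU WV yV zW j t) _.
  by rewrite rS /E; lra.
Qed.

(** 4500 is 450 times the sum 10 of the geometric series of ratio [9/10]. *)
Definition disc_bound (R : realType) (M g : nat) : R :=
  4500 * Num.sqrt (2 ^+ M) * (9 / 10) ^+ g.

Lemma disc_bound_ge0 (R : realType) (M g : nat) : 0 <= disc_bound R M g.
Proof.
apply: mulr_ge0; last by apply: exprn_ge0; lra.
by apply: mulr_ge0; [exact: ler0n|exact: sqrtr_ge0].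
Qed.

Lemma disc_boundS (R : realType) (M g : nat) :
  disc_bound R M g.+1 = 9 / 10 * disc_bound R M g.
Proof. by rewrite /disc_bound exprS mulrCA. Qed.

(** Each halving of the uncoloured set lowers [S] and raises [g] by one, and the errors add up since
    [450 + (9/10) * 4500 = 4500]. At [S = 0] the remainder is empty. *)
Lemma prefix_coloring (R : realType) (n : nat) (J : finType)
    (a : J -> 'I_n -> R) (U : {set 'I_n}) (M S g : nat) :
  (forall j i, `|a j i| <= 1) -> (#|J| <= 2 ^ M)%N -> (S + g = M)%N ->
  (#|U| <= 2 ^ S)%N ->
  exists y : 'I_n -> bool,
    forall j t, `|\sum_(i in U | (i < t)%N) a j i * sgn R (y i)| <= disc_bound R M g.
Proof.
move=> a1 JM; elim: S U g => [|S IH] U g SgM US;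
  have [y [V [VU VS yV]]] := half_prefix_coloring a1 JM SgM US.
  exists y => j t; have V0 : V = finset.set0 by apply: cards0_eq; move: VS; lia.
  move: (yV j t); rewrite V0 finset.setD0 => /le_trans; apply.
  rewrite /disc_bound -!mulrA; apply: ler_wpM2r; last by lra.
  by apply: mulr_ge0; [exact: sqrtr_ge0|apply: exprn_ge0; lra].
have VS' : (#|V| <= 2 ^ S)%N by move: VS; rewrite expnS; lia.
have [z zV] := IH V g.+1 (etrans (addnS _ _) SgM) VS'.
exists (fun i => if i \in V then z i else y i) => j t.
have := merge_prefix_colorings VU (finset.sub0set V) yV
  (e' := disc_bound R M g.+1) (z := z).
rewrite !finset.setD0 => /(_ zV j t) /le_trans; apply.
by rewrite disc_boundS /disc_bound; lra.
Qed.

(** * Paths of solutions *)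

(* Repeatedly keeping the coordinates of colour [+1] halves all the sums. The row of
   ones controls the cardinal of the set. *)
Lemma balanced_subset (R : realType) (n : nat) (J : finType)
    (a : J -> 'I_n -> R) (j1 : J) (M g : nat) :
  (forall j i, `|a j i| <= 1) -> (forall i, a j1 i = 1) ->
  (#|J| <= 2 ^ M)%N -> (2 * n <= 2 ^ M)%N -> (g <= M)%N ->
  2 * disc_bound R M 0 <= 2 ^+ M / 2 ^+ g.+1 ->
  forall l, (l <= g)%N -> exists K : {set 'I_n},
    (#|K| <= 2 ^ (M - l))%N /\
    forall j, `|\sum_(i in K) a j i - (\sum_i a j i) / 2 ^+ l|
      <= 2 * disc_bound R M l.
Proof.
move=> a1 j1E JM nM gM BM.
elim=> [_|l IH lg].
  exists [set: 'I_n]%SET; split.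
    by rewrite cardsT card_ord subn0; lia.
  move=> j; rewrite expr0 divr1 (eq_bigl xpredT) ?subrr ?normr0.
    by have := disc_bound_ge0 R M 0; lra.
  by move=> i; rewrite finset.inE.
have [K [KM KE]] := IH (ltnW lg).
have lM : (M - l + l = M)%N by rewrite subnK // (leq_trans _ gM) // ltnW.
have [y yE] := prefix_coloring a1 JM lM KM.
pose K' := [set i in K | ~~ y i].
(* The old error [2 * disc_bound R M l] and the signed sum, at most [disc_bound R M l], are halved;
   [3/2 <= 2 * (9/10)] closes the recursion. *)
have K'E j : `|\sum_(i in K') a j i - (\sum_i a j i) / 2 ^+ l.+1|
    <= 2 * disc_bound R M l.+1.
  have half : \sum_(i in K') a j i =
      (\sum_(i in K) a j i + \sum_(i in K | (i < n)%N) a j i * sgn R (y i)) / 2.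
    rewrite (eq_bigl (mem K) (fun i => a j i * _)); last by move=> i /=; rewrite ltn_ord andbT.
    rewrite -big_split mulr_suml /= big_mkcond [RHS]big_mkcond; apply: eq_bigr => i _.
    by rewrite finset.inE; case: (i \in K) => //; case: (y i); rewrite /sgn /=; field.
  have := yE j n; have := KE j; have := disc_bound_ge0 R M l.
  rewrite half disc_boundS exprSr invfM.
  move: (disc_bound R M l) (\sum_(i in K) _) (\sum_(i in K | _) _) (\sum_i _) => D p q s.
  rewrite !ler_norml => ? /andP[? ?] /andP[? ?]; apply/andP; split; lra.
exists K'; split=> //.
rewrite -(ler_nat R) natrX.
(* On the row of ones, [#|K'|] is at most [n / 2 ^ l.+1] plus the error, and each of the two is at
   most half of [2 ^ (M - l.+1)]. *)
have := K'E j1; rewrite (eq_bigr (fun=> 1)) // sumr_const.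
rewrite (eq_bigr (fun=> 1)) // sumr_const card_ord ler_norml => /andP[_].
have r2 : 2 * disc_bound R M l.+1 <= 2 ^+ M / 2 ^+ g.+1.
  apply: le_trans BM; elim: l.+1 => [//|k /(le_trans _)]; apply.
  by rewrite disc_boundS; have := disc_bound_ge0 R M k; lra.
have ML : 2 ^+ (M - l.+1) = 2 ^+ M / 2 ^+ l.+1 :> R.
  by rewrite expfB_cond // pnatr_eq0 /= add0n (leq_trans lg).
have gl : 2 ^+ M / 2 ^+ g.+1 <= 2 ^+ M / 2 ^+ l.+1 / 2 :> R.
  rewrite -mulrA -invfM -exprSr ler_wpM2l ?exprn_ge0 // lef_pV2 ?posrE ?exprn_gt0 //.
  by rewrite ler_eXn2l ?ltr1n.
have nl : n%:R / 2 ^+ l.+1 <= 2 ^+ M / 2 ^+ l.+1 / 2 :> R.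
  rewrite mulrAC ler_pM2r ?invr_gt0 ?exprn_gt0 // ler_pdivlMr // -natrX -natrM ler_nat.
  by rewrite mulnC.
rewrite ML; move: r2 gl nl.
move: (2 ^+ M / 2 ^+ g.+1) (2 ^+ M / 2 ^+ l.+1) (n%:R / 2 ^+ l.+1) => p q s.
by lra.
Qed.

(** The walk at time [t], starting from [X y] on [K] at [t = 0] and ending at its flip on [K] at
    [t = n]; addition of booleans is multiplication of signs. *)
Definition flipped (n : nat) (X : {ffun 'I_n -> bool}) (K : {set 'I_n})
    (y : 'I_n -> bool) (t : nat) : {ffun 'I_n -> bool} :=
  [ffun i => if i \in K then X i (+) (y i (+) (i < t)%N) else X i].

Lemma sum_flipped (R : realType) (n : nat) (X : {ffun 'I_n -> bool})
    (K : {set 'I_n}) (y : 'I_n -> bool) (t : nat) (h : 'I_n -> R) :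
  \sum_i h i * sgn R (flipped X K y t i)
    = \sum_i h i * sgn R (X i) - \sum_(i in K) h i * sgn R (X i)
      + (\sum_(i in K | (i < n)%N) h i * sgn R (X i) * sgn R (y i)
      - 2 * \sum_(i in K | (i < t)%N) h i * sgn R (X i) * sgn R (y i)).
Proof.
rewrite [\sum_(i in K) _]big_mkcond [\sum_(i in K | (i < n)%N) _]big_mkcond.
rewrite [\sum_(i in K | (i < t)%N) _]big_mkcond mulr_sumr -!sumrB -big_split.
apply: eq_bigr => i _ /=; rewrite ffunE ltn_ord andbT.
case: (i \in K) => /=; last by ring.
by rewrite !sgn_addb; case: (i < t)%N; rewrite {3}/sgn; ring.
Qed.

Lemma hamming_flipped (n : nat) (X : {ffun 'I_n -> bool}) (K : {set 'I_n})
    (y : 'I_n -> bool) : hamming (flipped X K y 0) (flipped X K y n) = #|K|.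
Proof.
apply: eq_card => i; rewrite finset.inE !ffunE ltn_ord ltn0.
by case: (i \in K); [case: (X i) (y i) => [] []|rewrite eqxx].
Qed.

Lemma connect_flipped (n : nat) (S : {set {ffun 'I_n -> bool}})
    (X : {ffun 'I_n -> bool}) (K : {set 'I_n}) (y : 'I_n -> bool) :
  (forall t, flipped X K y t \in S) ->
  connect (adjacent_in S) (flipped X K y 0) (flipped X K y n).
Proof.
move=> inS; suff step t : (t <= n)%N ->
  connect (adjacent_in S) (flipped X K y 0) (flipped X K y t) by exact: step.
elim: t => [|t IH tn]; first by rewrite connect0.
apply: connect_trans (IH (ltnW tn)) _.
have same i : i != Ordinal tn -> flipped X K y t i = flipped X K y t.+1 i.
  rewrite -val_eqE /= !ffunE => it; suff -> : (i < t.+1)%N = (i < t)%N by [].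
  by rewrite ltnS leq_eqVlt (negbTE it).
have [oK|oK] := boolP (Ordinal tn \in K); last first.
  rewrite (_ : flipped X K y t.+1 = flipped X K y t) ?connect0 //.
  apply/ffunP => i; have [->|/same->//] := eqVneq i (Ordinal tn).
  by rewrite !ffunE (negbTE oK).
apply: connect1; apply/and3P; split; rewrite ?inS //; apply/cards1P; exists (Ordinal tn).
apply/setP => i; rewrite !finset.inE.
have [->|/same->] := eqVneq i (Ordinal tn); last by rewrite eqxx.
by rewrite !ffunE oK /= ltnn ltnSn; case: (X _) (y _) => [] [].
Qed.

Lemma diameter_flipped (n : nat) (S : {set {ffun 'I_n -> bool}})
    (X : {ffun 'I_n -> bool}) (K : {set 'I_n}) (y : 'I_n -> bool) :
  (forall t, flipped X K y t \in S) ->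
  exists2 C, C \in clusters S & (#|K| <= diameter C)%N.
Proof.
move=> inS.
exists [set Z in S | connect (adjacent_in S) (flipped X K y 0) Z].
  by apply: imset_f.
rewrite -(hamming_flipped X K y); apply: leq_trans (leq_bigmax_cond _ _).
  by apply: leq_bigmax_cond; rewrite finset.inE inS connect_flipped.
by rewrite finset.inE inS connect0.
Qed.

(** If [T] is a row sum of [X], removing [K] costs [T / 2 ^ g] up to [2 * D], and the signed part on
    [K] costs at most [3 * D]. Weakening [2^-1 ^+ g] to [rho] lets both losses be taken at the rate
    [(9/10)^g]. *)
Lemma solutions_flipped (R : realType) (kappa kappa' D rho s : R) (g m n : nat)
    (G : 'M[bool]_(m, n)) (X : {ffun 'I_n -> bool}) (K : {set 'I_n})
    (y : 'I_n -> bool) :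
  0 < s -> s = Num.sqrt n%:R -> 2^-1 ^+ g <= rho <= 1 -> 0 <= kappa' ->
  s * kappa + 5 * D <= s * (kappa' * (1 - rho)) ->
  X \in solutions kappa' G ->
  (forall j, `|\sum_(i in K) sgn R (G j i) * sgn R (X i)
     - (\sum_i sgn R (G j i) * sgn R (X i)) / 2 ^+ g| <= 2 * D) ->
  (forall j t, `|\sum_(i in K | (i < t)%N)
     sgn R (G j i) * sgn R (X i) * sgn R (y i)| <= D) ->
  forall t, flipped X K y t \in solutions kappa G.
Proof.
move=> s0 sE /andP[grho rho1] k'0 gap; rewrite finset.inE => /forallP XS KE yE t.
rewrite finset.inE; apply/forallP => j.
rewrite -sE ler_pdivlMl // (sum_flipped X K y t (fun i => sgn R (G j i))).
have := XS j; rewrite -sE ler_pdivlMl //.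
have := yE j t; have := yE j n; have := KE j; rewrite -exprVn.
move: (\sum_(i in K) _) (\sum_(i in K | (i < n)%N) _) (\sum_(i in K | (i < t)%N) _).
move: (\sum_i _) (2^-1 ^+ g) grho => T r rrho p q w.
rewrite !ler_norml => /andP[p1 p2] /andP[q1 q2] /andP[w1 w2] Tk.
(* The sign of [T] allows [r] to be replaced by [rho] in [T * (1 - r)]; it comes from
   [0 <= kappa']. *)
have T0 : 0 <= T by apply: le_trans Tk; rewrite mulr_ge0 // ltW.
have : s * kappa' * (1 - rho) <= T * (1 - rho) by rewrite ler_wpM2r // subr_ge0.
have : T * r <= T * rho by rewrite ler_wpM2l.
lra.
Qed.

Lemma margin_gap (R : realType) (kappa kappa' c r : R) :
  (kappa' + 5 * c) * r <= kappa' - kappa ->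
  kappa + 5 * (c * r) <= kappa' * (1 - r).
Proof. lra. Qed.

Lemma disc_bound_sqrt (R : realType) : exists2 b : R, 1 <= b &
  forall M g, disc_bound R M g = b * Num.sqrt (2 ^+ M) * (9 / 10) ^+ g.
Proof. by exists 4500 => //; rewrite ler1n. Qed.

(** [2 ^ M] must dominate the [m.+1] rows, including the row of ones, and [2 * n], while the upper
    bound keeps its square root of order [sqrt n] when [m] is of order [n]. *)
Lemma pow2_between (m n : nat) : exists M,
  [/\ (m < 2 ^ M)%N, (2 * n <= 2 ^ M)%N & (2 ^ M <= 4 * maxn m.+1 n)%N].
Proof.
have x1 : (1 < 2 * maxn m.+1 n)%N by lia.
have /andP[lo hi] := up_log_bounds (isT : (1 < 2)%N) x1.
exists (up_log 2 (2 * maxn m.+1 n)); move: lo hi.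
by case: (up_log _ _) => [|M] /=; rewrite ?expn0 ?expnS => lo hi; split; lia.
Qed.

(** The deterministic core: [d] and [N] are chosen before [m], [n] and [G], so probability enters
    only through the existence of a solution at margin [kappa']. *)
Lemma large_cluster (R : realType) (kappa kappa' alpha : R) :
  0 < kappa -> kappa < kappa' -> 0 < alpha ->
  exists d N : R, 0 < d /\ forall (m n : nat) (G : 'M[bool]_(m, n)),
    N <= n%:R -> m%:R <= alpha * n%:R -> solutions kappa' G != finset.set0 ->
    [exists C in clusters (solutions kappa G), d * n%:R <= (diameter C)%:R].
Proof.
move=> k0 kk' alpha0.
have half_le (x q k : R) : - x <= k - 2 * q -> x <= q -> q <= k by lra.
have [b b1 bE] := disc_bound_sqrt R.
(* [C] is such that [sqrt (2 ^ M) <= C * sqrt n], as [2 ^ M <= 4 * maxn m.+1 n <= 4 * (alpha + 1) *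
   n]. *)
have [C C1 C2] : exists2 C : R, 1 <= C & C ^+ 2 = 4 * (alpha + 1).
  exists (2 * Num.sqrt (alpha + 1)); last by rewrite exprMn sqr_sqrtr; lra.
  by have : 1 <= Num.sqrt (alpha + 1); [rewrite -[leLHS]sqrtr1 ler_wsqrtr //; lra|lra].
have [P PE] : exists P : R, P = kappa' + 5 * (b * C) by eexists.
have b0 : 0 <= b by exact: le_trans ler01 b1.
have C0 : 0 <= C by exact: le_trans ler01 C1.
have k'0 : 0 <= kappa' by exact: ltW (lt_trans k0 kk').
have bbC : b <= b * C by rewrite ler_peMr.
have pow_le1 (k : nat) : 2^-1 ^+ k <= (9 / 10 : R) ^+ k <= 1.
  apply/andP; split; first by apply: lerXn2r; rewrite ?nnegrE; lra.
  by apply: exprn_ile1; lra.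
have pow_ge0 (k : nat) : 0 <= (9 / 10) ^+ k :> R by apply: exprn_ge0; lra.
have bC1 : 1 <= b * C by rewrite -[leLHS]mul1r; apply: ler_pM; lra.
have P0 : 0 < P by rewrite PE; lra.
have [g gP] : exists g, P * (9 / 10) ^+ g <= kappa' - kappa.
  have : (9 / 10 : R) ^+ k @[k --> \oo] --> (0 : R).
    by apply: cvg_expr; rewrite ger0_norm; lra.
  move/cvgr_lt => /(_ ((kappa' - kappa) / P)) /(_ _)/filter_ex[].
    by rewrite divr_gt0 // subr_gt0.
  by move=> g; rewrite ltr_pdivlMr // mulrC => /ltW; exists g.
have [p pE] : exists p : R, p = 2 ^+ g.+1 by eexists.
have p1 : 1 <= p by rewrite pE -natrX ler1n expn_gt0.
have p0 : 0 < p by exact: lt_le_trans ltr01 p1.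
(* For [sqrt n >= Q], the discrepancy at [g = 0] is small enough for [balanced_subset], and the
   error [2 * D] on [#|K|] is at most [n / 2 ^ g.+1]. *)
have [Q QE] : exists Q : R, Q = 2 * (b * C) * p by eexists.
have Q1 : 1 <= Q by rewrite QE; move: (b * C) bC1 => c c1; nra.
exists p^-1, (Q ^+ 2); split; first by rewrite invr_gt0; lra.
move=> m n G Qn mn /finset.set0Pn[X XS].
have [s sE] : exists s : R, s = Num.sqrt n%:R by eexists.
have s2 : s ^+ 2 = n%:R by rewrite sE sqr_sqrtr // ler0n.
have Qs : Q <= s by rewrite sE -[Q]ger0_norm -?sqrtr_sqr ?ler_wsqrtr //; lra.
have s1 : 1 <= s by exact: le_trans Q1 Qs.
have s0 : 0 < s by exact: lt_le_trans ltr01 s1.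
have ns : s <= n%:R by rewrite -s2 expr2 ler_peMr // ltW.
have [M [mM nM Mmax]] := pow2_between m n.
(* [None] indexes the row of ones. *)
pose J : finType := option 'I_m.
have JM : (#|J| <= 2 ^ M)%N by rewrite card_option card_ord.
pose B : R := Num.sqrt (2 ^+ M).
have B0 : 0 <= B by exact: sqrtr_ge0.
have B2 : B ^+ 2 = 2 ^+ M by rewrite sqr_sqrtr // exprn_ge0.
have sB : s <= B by rewrite sE ler_wsqrtr // -natrX ler_nat (leq_trans _ nM) // leq_pmull.
have BC : B <= C * s.
  rewrite -ler_sqr ?nnegrE //; last by rewrite mulr_ge0 // ltW.
  rewrite exprMn s2 B2 C2 -natrX; apply: (le_trans (y := (4 * maxn m.+1 n)%:R)).
    by rewrite ler_nat.
  rewrite natrM -mulrA ler_wpM2l //.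
  case: leqP => _; first by nra.
  by rewrite -natr1; nra.
have D0E : disc_bound R M 0 = b * B by rewrite bE expr0 mulr1.
have D0Q : 2 * disc_bound R M 0 * p <= 2 ^+ M.
  rewrite D0E -B2 expr2 (_ : _ * p = B * (2 * b * p)); last by ring.
  apply: ler_wpM2l => //; apply: le_trans sB; apply: le_trans Qs; rewrite QE.
  by apply: ler_wpM2r; [exact: ltW|exact: ler_wpM2l].
have gM : (g <= M)%N.
  rewrite -(@leq_exp2l 2) // -(ler_nat R) !natrX; apply: le_trans D0Q.
  rewrite D0E pE exprS mulrA ler_peMl ?exprn_ge0 //.
  by rewrite !mulr_ege1 ?ler1n // (le_trans s1 sB).
pose a (j : J) (i : 'I_n) : R :=
  if j is Some j' then sgn R (G j' i) * sgn R (X i) else 1.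
have a1 j i : `|a j i| <= 1.
  by case: j => [j|] /=; rewrite ?normrM /sgn ?normr_sign ?mulr1 ?normr1.
have D0M : 2 * disc_bound R M 0 <= 2 ^+ M / 2 ^+ g.+1.
  by rewrite -pE ler_pdivlMr.
have [K [KM KE]] := balanced_subset a1 (fun i => erefl (a None i)) JM nM gM D0M (leqnn g).
have [y yE] := prefix_coloring a1 JM (subnK gM) KM.
set D := disc_bound R M g in KE yE.
have DC : D <= b * (C * s) * (9 / 10) ^+ g.
  by rewrite /D bE ler_wpM2r // ler_wpM2l.
have inS : forall t, flipped X K y t \in solutions kappa G.
  apply: (@solutions_flipped _ _ kappa' D ((9 / 10) ^+ g) s g) => //.
  - apply: (le_trans (y := s * (kappa + 5 * (b * C * (9 / 10) ^+ g)))).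
      rewrite mulrDr lerD2l (_ : s * (5 * _) = 5 * (b * (C * s) * (9 / 10) ^+ g)).
        by rewrite ler_wpM2l.
      by ring.
    apply: ler_wpM2l; first exact: ltW.
    by move: gP; rewrite PE; exact: margin_gap.
  - by move=> j; apply: (KE (Some j)).
  - by move=> j t; apply: (yE (Some j)).
have [L LC LK] := diameter_flipped inS.
apply/existsP; exists L; rewrite LC /=.
apply: le_trans (_ : #|K|%:R <= _); last by rewrite ler_nat.
(* The row of ones gives [#|K| >= n / 2 ^ g - 2 * D], twice the target [p^-1 * n] minus an error no
   larger than the target. *)
have := KE None; rewrite /a !sumr_const card_ord ler_norml => /andP[lo _].
have n0 : n%:R / 2 ^+ g = 2 * (p^-1 * n%:R).
  by rewrite pE exprS invfM !mulrA divff ?pnatr_eq0 // mul1r mulrC.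
apply: (half_le (2 * D)); first by rewrite -n0.
rewrite [leRHS]mulrC ler_pdivlMr //.
apply: (le_trans (y := Q * s)); last by rewrite -s2 expr2 ler_wpM2r // ltW.
rewrite QE (_ : _ * p * s = 2 * (b * (C * s)) * p); last by ring.
apply: ler_wpM2r; first exact: ltW.
apply: ler_wpM2l => //; apply: le_trans DC _; apply: ler_piMr.
  by rewrite !mulr_ge0 // ltW.
by case/andP: (pow_le1 g).
Qed.

(** * Probabilities *)

Lemma Pr_le (R : realType) (m n : nat) (E F : pred 'M[bool]_(m, n)) :
  (forall G, E G -> F G) -> Pr R E <= Pr R F.
Proof.
move=> EF; rewrite /Pr big_mkcond [leRHS]big_mkcond; apply: ler_sum => G _.
have G0 : 0 <= mx_law R G.
  by apply: prodr_ge0 => j _; apply: prodr_ge0 => i _; rewrite invr_ge0.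
by case: ifP => [/EF ->//|_]; case: ifP.
Qed.

Lemma Pr_le1 (R : realType) (m n : nat) (E : pred 'M[bool]_(m, n)) : Pr R E <= 1.
Proof.
apply: le_trans (Pr_le R (F := predT) _) _ => //.
rewrite /Pr /mx_law /entry_law; under eq_bigr do rewrite !prodr_const !card_ord.
rewrite sumr_const card_mx card_bool -(mulr_natr _ (2 ^ _)) natrX mulnC exprM -!exprMn.
by rewrite mulVf ?pnatr_eq0 // !expr1n.
Qed.

Theorem corollary2p2 (R : realType) (alpha_c : R -> R)
  (no_solution : forall kappa : R, 0 < kappa ->
     forall alpha : R, 0 < alpha -> alpha_c kappa < alpha ->
     whp alpha (fun n G => solutions kappa G == finset.set0))
  (has_solution : forall kappa : R, 0 < kappa ->
     forall alpha : R, 0 < alpha -> alpha < alpha_c kappa ->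
     whp alpha (fun n G => solutions kappa G != finset.set0))
  (right_cont : forall kappa : R, 0 < kappa ->
     alpha_c x @[x --> kappa^'+] --> alpha_c kappa) :
  forall kappa : R, 0 < kappa ->
  forall alpha : R, 0 < alpha -> alpha < alpha_c kappa ->
  exists2 d : R, 0 < d &
    whp alpha (fun n G =>
      [exists C in clusters (solutions kappa G),
         d * n%:R <= (diameter C)%:R]).
Proof.
move=> kappa k0 alpha a0 ac.
have [kappa' [ac' kk']] : exists k, alpha < alpha_c k /\ kappa < k.
  apply: (@filter_ex _ kappa^'+); apply: filterI; last exact: nbhs_right_gt.
  exact: (cvgr_gt _ (right_cont _ k0)) ac.
have [d [N [d0 dN]]] := large_cluster k0 kk' a0.
exists d => //.
have sol := has_solution _ (lt_trans k0 kk') _ a0 ac'.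
(* Squeeze between the probability of a solution at margin [kappa'] and 1. *)
rewrite /whp in sol *; apply: squeeze_cvgr sol (cvg_cst _).
near=> n; rewrite Pr_le1 andbT; apply: Pr_le => G; apply: dN.
  by near: n; exact: nbhs_infty_ger.
by rewrite /nrows truncn_le mulr_ge0 // ltW.
Unshelve. all: by end_near.
Qed.
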